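(* Consider an irreducible $(2,2)$ correspondence with a double point at $(0,0)$: $$\mathcal C:\ a_{22}x^2y^2+a_{21}x^2y+a_{20}x^2+a_{12}xy^2+a_{11}xy+a_{02}y^2=0,$$ with complex coefficients. Then: (1) If $a_{11}^2\neq4a_{20}a_{02}$, then the singularity at the origin is an ordinary double point, and the QRT transformation of $\mathcal C$ is $n$-periodic if and only if there exists a natural number $m$ such that $$\frac{a_{11}^2}{4a_{20}a_{02}}=\cos^2\Big(\frac{m}{n}\pi\Big).$$ (2) If $a_{11}^2=4a_{20}a_{02}$, then the singularity at the origin is a cusp and the QRT transformation of $\mathcal C$ is not periodic.
   Context: A $(2,2)$ correspondence is the curve in $\mathbb P^1\times\mathbb P^1$ obtained as the bihomogeneous closure (bidegree $(2,2)$) of the zero set of a polynomial $Q(x,y)$ of degree two in each variable. The horizontal switch $h:(x,y)\mapsto(x',y)$ exchanges the two points of the curve with the same $y$, the vertical switch $v:(x,y)\mapsto(x,y')$ exchanges the two points with the same $x$, and the QRT transformation is $\delta=v\circ h$. It is $n$-periodic if $\delta^n=\mathrm{Id}$, and periodic if it is $n$-periodic for some $n\ge1$. (Irreducibility implies $a_{20}a_{02}\neq0$.) *)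

(* Defs.v *)
From HB Require Import structures.
From mathcomp Require Import all_boot all_order all_algebra.
From mathcomp Require Import boolp classical_sets reals trigo complex ring.

Set Implicit Arguments.
Unset Strict Implicit.
Unset Printing Implicit Defensive.

Import Order.TTheory GRing.Theory Num.Theory.
Local Open Scope ring_scope.

(* A polynomial Q(x, y) is an element of {poly {poly K}} with the conventions
   of polyXY: x is the outer variable 'X, y is the inner variable 'Y, so that
   Q`_i`_j is the coefficient of x ^+ i * y ^+ j. *)

Definition irreducible_elt (D : idomainType) (p : D) : Prop :=
  p \isn't a GRing.unit /\
  (forall q r : D, p = q * r -> q \is a GRing.unit \/ r \is a GRing.unit).

Section Correspondence.
Variable K : closedFieldType.

(* The projective line over K: Some x is the affine point (x : 1) and None is
   the point at infinity (1 : 0). *)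
Definition P1 : Type := option K.

Definition hcoord (x : P1) : K * K := if x is Some a then (a, 1) else (1, 0).

Definition biform (Q : {poly {poly K}}) (x y : K * K) : K :=
  \sum_(i < 3) \sum_(j < 3)
    Q`_i`_j * (x.1 ^+ i * x.2 ^+ (2 - i)) * (y.1 ^+ j * y.2 ^+ (2 - j)).

Definition on_curve (Q : {poly {poly K}}) (p : P1 * P1) : Prop :=
  biform Q (hcoord p.1) (hcoord p.2) = 0.

(* The zeros, counted with multiplicity, of the binary quadratic form f are
   x and x'; in particular f is not identically zero. *)
Definition zeros (f : K * K -> K) (x x' : P1) : Prop :=
  exists2 c : K, c != 0 & forall u : K * K,
    f u = c * (u.1 * (hcoord x).2 - u.2 * (hcoord x).1)
            * (u.1 * (hcoord x').2 - u.2 * (hcoord x').1).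

(* The second zero is selected with the choice operator xget. It is unique by
   zeros_inj. By zeros_ex_h and zeros_ex_v it exists as soon as the horizontal
   (resp. vertical) line through p is not contained in the curve, hence at
   every point of an irreducible curve. *)
Definition hswitch (Q : {poly {poly K}}) (p : P1 * P1) : P1 * P1 :=
  (xget p.1 [set x' | zeros (fun u => biform Q u (hcoord p.2)) p.1 x']%classic,
   p.2).

Definition vswitch (Q : {poly {poly K}}) (p : P1 * P1) : P1 * P1 :=
  (p.1,
   xget p.2 [set y' | zeros (fun u => biform Q (hcoord p.1) u) p.2 y']%classic).

Definition QRT (Q : {poly {poly K}}) : P1 * P1 -> P1 * P1 :=
  vswitch Q \o hswitch Q.

Definition qrt_n_periodic (Q : {poly {poly K}}) (n : nat) : Prop :=
  forall p : P1 * P1, on_curve Q p -> iter n (QRT Q) p = p.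

Definition qrt_periodic (Q : {poly {poly K}}) : Prop :=
  exists2 n : nat, (0 < n)%N & qrt_n_periodic Q n.

Definition hom_part (Q : {poly {poly K}}) (d : nat) (x y : K) : K :=
  \sum_(i < d.+1) Q`_i`_(d - i) * x ^+ i * y ^+ (d - i).

Definition double_point (Q : {poly {poly K}}) : Prop :=
  (forall d : nat, (d < 2)%N -> forall x y : K, hom_part Q d x y = 0) /\
  (exists x y : K, hom_part Q 2 x y != 0).

Definition ordinary_double_point (Q : {poly {poly K}}) : Prop :=
  double_point Q /\
  exists a b c d : K, a * d - b * c != 0 /\
    forall x y : K, hom_part Q 2 x y = (a * x + b * y) * (c * x + d * y).

(* The polynomial Q(u t, v t) in t, the variable of {poly K}. *)
Definition restrict_line (Q : {poly {poly K}}) (u v : K) : {poly K} :=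
  (map_poly (fun q : {poly K} => q \Po (v *: 'X)) Q).[u *: 'X].

(* A double point whose only tangent is the line a x + b y = 0 (spanned by
   (b, - a)), this line having intersection multiplicity exactly 3 with the
   curve. *)
Definition cusp (Q : {poly {poly K}}) : Prop :=
  double_point Q /\
  exists a b : K,
    (forall x y : K, hom_part Q 2 x y = (a * x + b * y) ^+ 2) /\
    mup 0 (restrict_line Q b (- a)) = 3%N.

Lemma cross_eq0 (x y : P1) :
  (hcoord x).1 * (hcoord y).2 - (hcoord x).2 * (hcoord y).1 = 0 -> x = y.
Proof.
case: x => [x|]; case: y => [y|] //=; rewrite !(mulr1, mul1r, mulr0, mul0r).
- by move/eqP; rewrite subr_eq0 => /eqP ->.
- by move/eqP; rewrite sub0r oppr_eq0 oner_eq0.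
- by move/eqP; rewrite subr0 oner_eq0.
Qed.

Lemma zeros_inj (f : K * K -> K) (x y z : P1) :
  zeros f x y -> zeros f x z -> y = z.
Proof.
have step (t w : P1) : zeros f x t -> zeros f x w -> t = x \/ t = w.
  move=> [c c0 fc] [d d0 fd].
  have /eqP : f (hcoord t) = 0 by rewrite fc; ring.
  rewrite fd !mulf_eq0 (negPf d0) /= => /orP[] /eqP /cross_eq0 ->.
    by left.
  by right.
move=> xy xz; have [yx|//] := step _ _ xy xz.
by have [zx|//] := step _ _ xz xy; rewrite yx zx.
Qed.

Lemma zeros_ex_quadratic (f : K * K -> K) (a b c : K) (x : P1) :
  (forall u, f u = a * u.1 ^+ 2 + b * (u.1 * u.2) + c * u.2 ^+ 2) ->
  (exists u, f u != 0) -> f (hcoord x) = 0 -> exists x', zeros f x x'.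
Proof.
move=> fE [u0 fu0]; rewrite fE; case: x => [x|] /=; last first.
  rewrite expr1n expr0n /= !mulr0 !mulr1 !addr0 => a0.
  have [b0|b0] := eqVneq b 0.
    exists None, c => /= [|u]; last by rewrite fE a0 b0; ring.
    by apply: contra_neq fu0 => c0; rewrite fE a0 b0 c0; ring.
  exists (Some (- c / b)), (- b) => /= [|u]; first by rewrite oppr_eq0.
  by rewrite fE a0; field.
rewrite expr1n !mulr1 => h.
have cE : c = - (a * x ^+ 2 + b * x).
  by apply/eqP; rewrite -addr_eq0 addrC h.
have [a0|a0] := eqVneq a 0.
  exists None, (- b) => /= [|u]; last by rewrite fE cE a0; ring.
  rewrite oppr_eq0.
  by apply: contra_neq fu0 => b0; rewrite fE cE a0 b0; ring.
exists (Some (- (a * x + b) / a)), a => //= u.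
by rewrite fE cE; field.
Qed.

Lemma zeros_ex_h (Q : {poly {poly K}}) (p : P1 * P1) :
  on_curve Q p -> (exists u, biform Q u (hcoord p.2) != 0) ->
  exists x', zeros (fun u => biform Q u (hcoord p.2)) p.1 x'.
Proof.
move=> cp nz; pose y := hcoord p.2.
pose A i := \sum_(j < 3) Q`_i`_j * (y.1 ^+ j * y.2 ^+ (2 - j)).
apply: (@zeros_ex_quadratic _ (A 2) (A 1) (A 0)) => // u.
by rewrite /biform /A -/y !big_ord_recl !big_ord0 /=; ring.
Qed.

Lemma zeros_ex_v (Q : {poly {poly K}}) (p : P1 * P1) :
  on_curve Q p -> (exists u, biform Q (hcoord p.1) u != 0) ->
  exists y', zeros (fun u => biform Q (hcoord p.1) u) p.2 y'.
Proof.
move=> cp nz; pose x := hcoord p.1.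
pose A j := \sum_(i < 3) Q`_i`_j * (x.1 ^+ i * x.2 ^+ (2 - i)).
apply: (@zeros_ex_quadratic _ (A 2) (A 1) (A 0)) => // u.
by rewrite /biform /A -/x !big_ord_recl !big_ord0 /=; ring.
Qed.

End Correspondence.

(* Main.v *)
Require Import Defs.
From mathcomp Require Import all_boot all_order all_algebra.
From mathcomp Require Import boolp classical_sets reals trigo complex ring.

Import Order.TTheory GRing.Theory Num.Theory.
Local Open Scope ring_scope.
Local Open Scope complex_scope.

(* In the coordinates u = 1/x, v = 1/y the curve minus its double point becomes
   the affine conic
     a20 v^2 + a11 u v + a02 u^2 + a21 v + a12 u + a22 = 0,
   and both switches become restrictions of affine involutions of the plane.
   If the quadratic part splits as (p v + q u) (r v + s u) with distinct factors,
   the affine forms L1 = p v + q u + e and L2 = r v + s u + f centred at the conic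
   are eigenvectors of the QRT map, for lam = p s / (q r) and 1 / lam. So delta^n = 1
   iff lam^n = 1, and a11^2 / (4 a20 a02) = (lam + 1)^2 / (4 lam).
   If the quadratic part is (p v + q u)^2, the QRT map translates p v + q u by
   (a12 p - a21 q) / (p q), which is nonzero since otherwise Q would factor. *)

(** * Complex exponential and roots of unity *)

Definition expi {R : realType} (x : R) : R[i] := cos x +i* sin x.

Lemma expiD (R : realType) (x y : R) : expi (x + y) = expi x * expi y.
Proof.
rewrite /expi cosD sinD; apply/eqP.
by rewrite eq_complex /= eqxx [X in _ == X]addrC eqxx.
Qed.

Lemma expiMn (R : realType) (x : R) n : expi (x *+ n) = expi x ^+ n.
Proof.
elim: n => [|n IH]; first by rewrite mulr0n /expi cos0 sin0.
by rewrite mulrS expiD IH exprS.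
Qed.

Lemma expi_neq0 (R : realType) (x : R) : expi x != 0.
Proof.
apply/eqP => e0; have := oner_neq0 R[i].
have -> : 1 = expi (x - x) by rewrite subrr /expi cos0 sin0.
by rewrite expiD e0 mul0r eqxx.
Qed.

Lemma expi2pi (R : realType) : expi (pi *+ 2 : R) = 1.
Proof. by rewrite /expi cos2pi sin2pi. Qed.

Lemma cos_expi (R : realType) (x : R) :
  (cos x)%:C = (expi x + (expi x)^-1) / 2.
Proof.
have -> : (expi x)^-1 = expi (- x).
  apply: (mulfI (expi_neq0 _ x)); rewrite mulfV ?expi_neq0 // -expiD subrr.
  by rewrite /expi cos0 sin0.
apply: (mulIf (_ : 2 != 0 :> R[i])); first by rewrite pnatr_eq0.
rewrite divfK ?pnatr_eq0 // /expi cosN sinN.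
apply/eqP; rewrite eq_complex /=; apply/andP; split; apply/eqP; ring.
Qed.

(** If the order [m] of [z] were below [n], then [y = pi m / n] would lie strictly between 0 and
    [pi], so [cos (2 y) = 1 - 2 sin^2 y] could not be 1. *)
Lemma expi_prim_root (R : realType) n : (0 < n)%N ->
  n.-primitive_root (expi (pi *+ 2 / n%:R : R)).
Proof.
move=> n0; set z := expi _.
have zn : z ^+ n = 1.
  by rewrite /z -expiMn -[X in expi X]mulr_natr divfK ?expi2pi // pnatr_eq0 -lt0n.
have [m zm mn] := prim_order_exists n0 zn.
suff -> : n = m by [].
apply/eqP; rewrite eqn_leq andbC dvdn_leq //= leqNgt; apply/negP => lt_mn.
have m0 := prim_order_gt0 zm.
have := prim_expr_order zm; rewrite /z -expiMn => -[+ _].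
have -> : pi *+ 2 / n%:R *+ m = (pi * (m%:R / n%:R)) *+ 2 :> R.
  by rewrite -[LHS]mulr_natr; ring.
rewrite cos_mulr2n cos2sin2.
set y := pi * _; have sy : 0 < sin y.
  apply: sin_gt0_pi; rewrite mulr_gt0 ?pi_gt0 ?divr_gt0 ?ltr0n //=.
  by rewrite gtr_pMr ?pi_gt0 // ltr_pdivrMr ?ltr0n // mul1r ltr_nat.
move=> h; have : 2 * sin y ^+ 2 = 1 - ((1 - sin y ^+ 2) *+ 2 - 1) by ring.
by rewrite h subrr; apply/eqP; rewrite mulf_neq0 ?pnatr_eq0 // expf_neq0 // gt_eqF.
Qed.

(* With z = expi (m pi / n), (lam + 1)^2 / (4 lam) = ((z + 1 / z) / 2)^2 says that
   lam = z^2 or lam = z^-2. *)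
Lemma root_of_unity_cos (R : realType) (lam : R[i]) n : (0 < n)%N -> lam != 0 ->
  lam ^+ n = 1 <-> exists m : nat,
    (lam + 1) ^+ 2 / (4 * lam) = (cos (m%:R / n%:R * pi : R) ^+ 2)%:C.
Proof.
move=> n0 lam0; have nn : n%:R != 0 :> R by rewrite pnatr_eq0 -lt0n.
split=> [lamn | [m]].
- have [m ->] := prim_rootP (expi_prim_root R _ n0) lamn; exists m.
  rewrite rmorphXn /= cos_expi -expiMn.
  have -> : pi *+ 2 / n%:R *+ m = (m%:R / n%:R * pi) *+ 2 :> R.
    by rewrite -[LHS]mulr_natr; ring.
  by rewrite expiMn; field; rewrite expi_neq0.
- rewrite rmorphXn /= cos_expi; set z := expi _ => h.
  have z0 : z != 0 by exact: expi_neq0.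
  (* [z ^+ n] itself may be -1; only its square enters, since [lam] will be [z ^+ 2] or its
     inverse. *)
  have zn : z ^+ n ^+ 2 = 1.
    rewrite -exprM /z -expiMn.
    have -> : m%:R / n%:R * pi *+ (n * 2) = (pi *+ 2) *+ m :> R.
      by rewrite -[LHS]mulr_natr -[RHS]mulr_natr natrM; field.
    by rewrite expiMn expi2pi expr1n.
  have : (lam - z ^+ 2) * (lam * z ^+ 2 - 1) = 0.
    transitivity (4 * lam * z ^+ 2 * ((lam + 1) ^+ 2 / (4 * lam) - ((z + z^-1) / 2) ^+ 2)).
      by field; rewrite lam0 z0.
    by rewrite h subrr mulr0.
  move/eqP; rewrite mulf_eq0 !subr_eq0 => /orP[] /eqP lamE.
    by rewrite lamE exprAC.
  have := congr1 (fun t => t ^+ n) lamE.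
  by rewrite exprMn expr1n [z ^+ 2 ^+ n]exprAC zn mulr1.
Qed.

(** A unit is a nonzero constant, so two factors through the origin would give a proper
    factorization. All uses of irreducibility below go through this test. *)
Lemma irreducible_factor_origin (D : idomainType) (F G : {poly {poly D}}) :
  irreducible_elt (F * G) -> F.[0].[0] = 0 -> G.[0].[0] != 0.
Proof.
have nu (P : {poly {poly D}}) : P.[0].[0] = 0 -> P \isn't a GRing.unit.
  rewrite !horner_coef0 => P0.
  by rewrite poly_unitE negb_and poly_unitE P0 unitr0 andbF orbT.
move=> [_ irr] F0; apply/eqP => G0.
by have [uF|uG] := irr _ _ erefl; [move/nu: F0 | move/nu: G0]; rewrite ?uF ?uG.
Qed.

(** * The chart [u = 1/x] of the projective line *)

Section ProjectiveLine.
Variable K : closedFieldType.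
Implicit Types (Q : {poly {poly K}}) (p : P1 K * P1 K).

Lemma hswitchE Q p x' :
  zeros (fun u => biform Q u (hcoord p.2)) p.1 x' -> hswitch Q p = (x', p.2).
Proof.
move=> zx; congr (_, _); apply: xget_unique => // z zz.
exact: zeros_inj zz zx.
Qed.

Lemma vswitchE Q p y' :
  zeros (fun u => biform Q (hcoord p.1) u) p.2 y' -> vswitch Q p = (p.1, y').
Proof.
move=> zy; congr (_, _); apply: xget_unique => // z zz.
exact: zeros_inj zz zy.
Qed.

Definition inv_pt (u : K) : P1 K := if u == 0 then None else Some u^-1.

(** Ratio between [hcoord (inv_pt u)] and the uniform representative [(1, u)]. It lets homogeneous
    computations avoid a case split on [u = 0]. *)
Definition inv_scale (u : K) : K := if u == 0 then 1 else u^-1.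

Lemma inv_scale_neq0 u : inv_scale u != 0.
Proof.
by rewrite /inv_scale; case: (eqVneq u 0) => [_|u0]; rewrite ?oner_neq0 ?invr_neq0.
Qed.

Lemma hcoord_inv_pt u : hcoord (inv_pt u) = (inv_scale u, inv_scale u * u).
Proof.
by rewrite /inv_pt /inv_scale; case: eqVneq => [->|u0] /=; rewrite ?mulr0 ?mulVf.
Qed.

Lemma inv_pt_inj : injective inv_pt.
Proof.
move=> u v; rewrite /inv_pt.
by do 2 case: eqVneq => [->|?] //; case=> /invr_inj.
Qed.

Lemma inv_ptP x : x = Some 0 \/ exists u, x = inv_pt u.
Proof.
case: x => [x|]; last by right; exists 0; rewrite /inv_pt eqxx.
have [->|x0] := eqVneq x 0; first by left.
by right; exists x^-1; rewrite /inv_pt invr_eq0 (negPf x0) invrK.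
Qed.

Definition inv_pts (w : K * K) : P1 K * P1 K := (inv_pt w.1, inv_pt w.2).

End ProjectiveLine.

Arguments inv_pt {K} u.
Arguments inv_scale {K} u.
Arguments inv_pts {K} w.

(** * Local form of the curve at the double point *)

Section Correspondence.
Variables (K : numClosedFieldType) (a22 a21 a20 a12 a11 a02 : K).

Let Q : {poly {poly K}} :=
  a22%:P%:P * 'X ^+ 2 * 'Y ^+ 2 + a21%:P%:P * 'X ^+ 2 * 'Y
  + a20%:P%:P * 'X ^+ 2 + a12%:P%:P * 'X * 'Y ^+ 2
  + a11%:P%:P * 'X * 'Y + a02%:P%:P * 'Y ^+ 2.

Lemma Q_as_poly : Q = \poly_(i < 3) nth 0
  [:: a02 *: 'X ^+ 2; a12 *: 'X ^+ 2 + a11 *: 'X;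
      a22 *: 'X ^+ 2 + a21 *: 'X + a20%:P] i.
Proof.
rewrite poly_def !big_ord_recl big_ord0 /=.
by rewrite -!mul_polyC !(polyCD, polyCM) /Q /bump /=; ring.
Qed.

Lemma biformE (x y : K * K) : biform Q x y =
  a22 * x.1 ^+ 2 * y.1 ^+ 2 + a21 * x.1 ^+ 2 * (y.1 * y.2)
  + a20 * x.1 ^+ 2 * y.2 ^+ 2 + a12 * (x.1 * x.2) * y.1 ^+ 2
  + a11 * (x.1 * x.2) * (y.1 * y.2) + a02 * x.2 ^+ 2 * y.1 ^+ 2.
Proof.
rewrite /biform Q_as_poly !big_ord_recl !big_ord0 /= !coef_poly /= /bump /=.
by rewrite !(coefE, coefD, coefZ, coefX, coefXn, coefC) /=; ring.
Qed.

Lemma hom_part_lt2 d x y : (d < 2)%N -> hom_part Q d x y = 0.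
Proof.
case: d => [|[|//]] _; rewrite /hom_part Q_as_poly !big_ord_recl !big_ord0 /=;
  by rewrite !coef_poly /= !(coefE, coefD, coefZ, coefX, coefXn, coefC) /=; ring.
Qed.

Lemma hom_part2 x y :
  hom_part Q 2 x y = a20 * x ^+ 2 + a11 * x * y + a02 * y ^+ 2.
Proof.
rewrite /hom_part Q_as_poly !big_ord_recl !big_ord0 /= !coef_poly /= /bump /=.
by rewrite !(coefE, coefD, coefZ, coefX, coefXn, coefC) /=; ring.
Qed.

Lemma double_point_origin : a20 != 0 -> double_point Q.
Proof.
move=> a0; split=> [d d2 x y|]; first exact: hom_part_lt2.
by exists 1, 0; rewrite hom_part2 !expr1n !(mulr0, mulr1, addr0) expr0n mulr0 addr0.
Qed.

Lemma restrict_lineE u v : restrict_line Q u v =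
  'X ^+ 2 * ((a20 * u ^+ 2 + a11 * u * v + a02 * v ^+ 2)%:P
   + (a21 * u ^+ 2 * v + a12 * u * v ^+ 2)%:P * 'X
   + (a22 * u ^+ 2 * v ^+ 2)%:P * 'X ^+ 2).
Proof.
rewrite /restrict_line -[map_poly _ _]/(map_poly (comp_poly (v *: 'X)) Q) /Q.
rewrite !(rmorphD, rmorphM, rmorphXn) /= !map_polyC /= !map_polyX !hornerE /=.
by rewrite !comp_polyC !comp_polyX -!mul_polyC; ring.
Qed.

(** If [a20 = 0], then ['Y] divides [Q] and the cofactor still vanishes at the origin. *)
Lemma irreducible_a20 : irreducible_elt Q -> a20 != 0.
Proof.
move=> irr; apply/eqP => a0.
have QE : Q = 'Y * (a22%:P%:P * 'X ^+ 2 * 'Y + a21%:P%:P * 'X ^+ 2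
    + a12%:P%:P * 'X * 'Y + a11%:P%:P * 'X + a02%:P%:P * 'Y).
  by rewrite /Q a0; ring.
move: irr; rewrite QE => /irreducible_factor_origin.
by rewrite !hornerE /= ?mulr0 eqxx => /(_ erefl).
Qed.

Lemma irreducible_a02 : irreducible_elt Q -> a02 != 0.
Proof.
move=> irr; apply/eqP => a0.
have QE : Q = 'X * (a22%:P%:P * 'X * 'Y ^+ 2 + a21%:P%:P * 'X * 'Y
    + a20%:P%:P * 'X + a12%:P%:P * 'Y ^+ 2 + a11%:P%:P * 'Y).
  by rewrite /Q a0; ring.
move: irr; rewrite QE => /irreducible_factor_origin.
by rewrite !hornerE /= ?mulr0 eqxx => /(_ erefl).
Qed.

(** Equality would make [(a21, a12)] a multiple [c (p, q)]. Then [Q] is the product of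
    [p x + q y + r x y] over the two roots [r] of [r^2 - c r + a22], and both factors pass through
    the origin. *)
Lemma irreducible_cusp_neq p q : irreducible_elt Q -> p != 0 ->
  a20 = p ^+ 2 -> a02 = q ^+ 2 -> a11 = 2 * p * q -> a12 * p != a21 * q.
Proof.
move=> irr p0 a20E a02E a11E; apply/eqP => t0.
pose c := a21 / p; pose D := sqrtC (c ^+ 2 - 4 * a22).
pose L r : {poly {poly K}} := p%:P%:P * 'X + q%:P%:P * 'Y + r%:P%:P * 'X * 'Y.
have a21E : a21 = c * p by rewrite /c divfK.
have a12E : a12 = c * q by apply: (mulIf p0); rewrite t0 a21E; ring.
pose r1 := (c + D) / 2; pose r2 := (c - D) / 2.
have cE : c = r1 + r2 by rewrite /r1 /r2; field.
have a22E : a22 = r1 * r2.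
  by transitivity ((c ^+ 2 - D ^+ 2) / 4); [rewrite sqrtCK | rewrite /r1 /r2]; field.
have QE : Q = L r1 * L r2.
  rewrite /Q /L a21E a12E a20E a02E a11E a22E cE.
  by rewrite !(rmorphM, rmorphD, rmorphXn, polyCD) /=; ring.
have L0 r : (L r).[0].[0] = 0 by rewrite /L !hornerE /= ?mulr0 ?addr0.
by move: irr; rewrite QE => /irreducible_factor_origin /(_ (L0 _)); rewrite L0 eqxx.
Qed.

Lemma node_ordinary p q r s : a20 != 0 ->
  a20 = p * r -> a11 = p * s + q * r -> a02 = q * s -> p * s - q * r != 0 ->
  ordinary_double_point Q.
Proof.
move=> a0 a20E a11E a02E d0; split; first exact: double_point_origin.
exists p, q, r, s; split=> // x y.
by rewrite hom_part2 a20E a11E a02E; ring.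
Qed.

(** Along the tangent direction [(q, - p)] the quadratic term cancels and the cubic coefficient is
    [p q (a12 p - a21 q)]. *)
Lemma cusp_origin p q : p != 0 -> q != 0 ->
  a20 = p ^+ 2 -> a02 = q ^+ 2 -> a11 = 2 * p * q -> a12 * p != a21 * q ->
  cusp Q.
Proof.
move=> p0 q0 a20E a02E a11E t0; split.
  by apply: double_point_origin; rewrite a20E expf_neq0.
exists p, q; split=> [x y|]; first by rewrite hom_part2 a20E a02E a11E; ring.
rewrite restrict_lineE a20E a02E a11E.
set g := (X in mup _ X).
have -> : g = ('X - 0%:P) ^+ 3 * ((p * q * (a12 * p - a21 * q))%:P
   + (a22 * q ^+ 2 * p ^+ 2)%:P * 'X).
  rewrite /g.
  have -> : p ^+ 2 * q ^+ 2 + 2 * p * q * q * - p + q ^+ 2 * (- p) ^+ 2 = 0 by ring.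
  by rewrite subr0 !(polyCM, polyCD, polyCN) /=; ring.
rewrite mupMl ?mup_XsubCX ?eqxx //.
by rewrite rootE !hornerE /= mulf_neq0 ?mulf_neq0 // subr_eq0.
Qed.

(** * The switches as affine involutions of the conic *)

Definition conic (w : K * K) : K :=
  a22 + a21 * w.2 + a20 * w.2 ^+ 2 + a12 * w.1 + a11 * w.1 * w.2 + a02 * w.1 ^+ 2.

Lemma on_curve_inv u v : on_curve Q (inv_pt u, inv_pt v) <-> conic (u, v) = 0.
Proof.
rewrite /on_curve /= !hcoord_inv_pt biformE /=.
have -> : forall x y : K,
    a22 * x ^+ 2 * y ^+ 2 + a21 * x ^+ 2 * (y * (y * v)) +
    a20 * x ^+ 2 * (y * v) ^+ 2 + a12 * (x * (x * u)) * y ^+ 2 +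
    a11 * (x * (x * u)) * (y * (y * v)) + a02 * (x * u) ^+ 2 * y ^+ 2
    = (x * y) ^+ 2 * conic (u, v) by move=> x y; rewrite /conic /=; ring.
split=> [/eqP|->]; last by rewrite mulr0.
by rewrite mulf_eq0 expf_eq0 mulf_eq0 !(negPf (inv_scale_neq0 _ _)) => /eqP.
Qed.

(** Vieta: for fixed [v], the two roots of [conic] in [u] sum to [- (a12 + a11 v) / a02]; [vconic]
    is the same with the coordinates exchanged. *)
Definition hconic (w : K * K) : K * K := (- w.1 - (a12 + a11 * w.2) / a02, w.2).
Definition vconic (w : K * K) : K * K := (w.1, - w.2 - (a21 + a11 * w.1) / a20).

Hypotheses (a20_neq0 : a20 != 0) (a02_neq0 : a02 != 0).

(** When exactly one coordinate is 0, the form reduces to a single term in [a02] or [a20], which is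
    nonzero; so the chart misses only the double point. *)
Lemma on_curveP p : on_curve Q p ->
  p = (Some 0, Some 0) \/ exists2 w, p = inv_pts w & conic w = 0.
Proof.
case: p => x y; have [->|[u ->]] := inv_ptP _ x; have [->|[v ->]] := inv_ptP _ y.
- by left.
- rewrite /on_curve hcoord_inv_pt biformE /= => /eqP.
  rewrite !(expr0n, expr1n, mulr0, mul0r, mulr1, add0r) /=.
  by rewrite !mulf_eq0 (negPf a02_neq0) !(negPf (inv_scale_neq0 _ _)).
- rewrite /on_curve hcoord_inv_pt biformE /= => /eqP.
  rewrite !(expr0n, expr1n, mulr0, mul0r, mulr1, addr0, add0r) /=.
  by rewrite !mulf_eq0 (negPf a20_neq0) !(negPf (inv_scale_neq0 _ _)).
- by move=> /on_curve_inv cw; right; exists (u, v).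
Qed.

(** On each axis the form is a constant times a square, so the double point is its own partner under
    both switches. *)
Lemma QRT_origin : QRT Q (Some 0, Some 0) = (Some 0, Some 0).
Proof.
rewrite /QRT /= (@hswitchE _ _ _ (Some 0)) ?(@vswitchE _ _ _ (Some 0)) //=.
- by exists a02 => // u; rewrite biformE /=; ring.
- by exists a20 => // u; rewrite biformE /=; ring.
Qed.

Lemma hswitch_inv w : conic w = 0 -> hswitch Q (inv_pts w) = inv_pts (hconic w).
Proof.
case: w => u v cw; apply: hswitchE => /=; rewrite /zeros !hcoord_inv_pt /=.
set u' := - u - _; have iu := inv_scale_neq0 _ u; have iu' := inv_scale_neq0 _ u'.
have iv := inv_scale_neq0 _ v.
(* The leading coefficient in [u] is [a02], rescaled by the representative of [v]; the division
   cancels the scales carried by the two linear factors. *)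
exists (a02 * inv_scale v ^+ 2 / (inv_scale u * inv_scale u')).
  by rewrite !mulf_neq0 ?invr_eq0 ?expf_neq0 ?mulf_neq0.
move=> x; rewrite biformE /=.
have a22E : a22 = - (a21 * v + a20 * v ^+ 2 + a12 * u + a11 * u * v + a02 * u ^+ 2).
  by apply/eqP; rewrite -addr_eq0 -cw /conic /=; apply/eqP; ring.
transitivity (inv_scale v ^+ 2 * a02 * (x.1 * u - x.2) * (x.1 * u' - x.2)).
  by rewrite a22E /u'; field.
by field; rewrite iu iu'.
Qed.

Lemma vswitch_inv w : conic w = 0 -> vswitch Q (inv_pts w) = inv_pts (vconic w).
Proof.
case: w => u v cw; apply: vswitchE => /=; rewrite /zeros !hcoord_inv_pt /=.
set v' := - v - _; have iv := inv_scale_neq0 _ v; have iv' := inv_scale_neq0 _ v'.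
have iu := inv_scale_neq0 _ u.
exists (a20 * inv_scale u ^+ 2 / (inv_scale v * inv_scale v')).
  by rewrite !mulf_neq0 ?invr_eq0 ?expf_neq0 ?mulf_neq0.
move=> x; rewrite biformE /=.
have a22E : a22 = - (a21 * v + a20 * v ^+ 2 + a12 * u + a11 * u * v + a02 * u ^+ 2).
  by apply/eqP; rewrite -addr_eq0 -cw /conic /=; apply/eqP; ring.
transitivity (inv_scale u ^+ 2 * a20 * (x.1 * v - x.2) * (x.1 * v' - x.2)).
  by rewrite a22E /v'; field.
by field; rewrite iv iv'.
Qed.

Lemma conic_h w : conic (hconic w) = conic w.
Proof. by rewrite /conic /=; field. Qed.

Lemma conic_v w : conic (vconic w) = conic w.
Proof. by rewrite /conic /=; field. Qed.

Lemma QRT_inv w : conic w = 0 ->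
  QRT Q (inv_pts w) = inv_pts (vconic (hconic w)).
Proof.
by move=> cw; rewrite /QRT /= hswitch_inv // vswitch_inv // conic_h.
Qed.

(** The chart is injective and conjugates the two maps, the conic is invariant, and the one
    remaining point is fixed. *)
Lemma qrt_n_periodicP n : qrt_n_periodic Q n <->
  forall w, conic w = 0 -> iter n (vconic \o hconic) w = w.
Proof.
have iterE w : conic w = 0 ->
    iter n (QRT Q) (inv_pts w) = inv_pts (iter n (vconic \o hconic) w).
  move=> cw; suff [//] : iter n (QRT Q) (inv_pts w)
      = inv_pts (iter n (vconic \o hconic) w)
    /\ conic (iter n (vconic \o hconic) w) = 0.
  elim: n => [//|n [IH cn]] /=; rewrite IH QRT_inv //; split=> //.
  by rewrite conic_v conic_h.
split=> [per [u v] cw | per p /on_curveP [->|[w -> cw]]].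
- have /per : on_curve Q (inv_pts (u, v)) by apply/on_curve_inv.
  rewrite iterE //; case: (iter _ _ _) => u' v'.
  by case=> /inv_pt_inj -> /inv_pt_inj ->.
- by elim: n {per iterE} => //= n ->; exact: QRT_origin.
- by rewrite iterE // per.
Qed.

(** * Ordinary double point: the conic as [L1 L2 = e f - a22] *)

Section Node.
Variables p q r s e f : K.
Hypotheses (a20E : a20 = p * r) (a11E : a11 = p * s + q * r) (a02E : a02 = q * s).
Hypotheses (a21E : a21 = p * f + r * e) (a12E : a12 = q * f + s * e).

(** [hconic] sends [(L1, L2)] to [(- (q / s) L2, - (s / q) L1)], and [vconic] sends it to
    [(- (p / r) L2, - (r / p) L1)]. Both hold on the whole plane, not only on the conic. *)
Lemma node_multiplier w : let w' := vconic (hconic w) in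
  p * w'.2 + q * w'.1 + e = p * s / (q * r) * (p * w.2 + q * w.1 + e) /\
  r * w'.2 + s * w'.1 + f = q * r / (p * s) * (r * w.2 + s * w.1 + f).
Proof.
have : a20 * a02 != 0 by rewrite mulf_neq0.
rewrite /hconic /vconic /= a20E a11E a02E a21E a12E !mulf_eq0 !negb_or.
move=> /andP[/andP[p0 r0] /andP[q0 s0]].
by split; field; rewrite p0 q0 r0 s0.
Qed.

Lemma node_periodic n : p * s - q * r != 0 ->
  qrt_n_periodic Q n <-> (p * s / (q * r)) ^+ n = 1.
Proof.
move=> d0; pose lam := p * s / (q * r).
have lamV : q * r / (p * s) = lam^-1 by rewrite /lam invf_div.
have iterE w : let w' := iter n (vconic \o hconic) w in
    p * w'.2 + q * w'.1 + e = lam ^+ n * (p * w.2 + q * w.1 + e) /\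
    r * w'.2 + s * w'.1 + f = lam^-1 ^+ n * (r * w.2 + s * w.1 + f).
  elim: n => [|n [IH1 IH2]] /=; first by rewrite !mul1r.
  have [-> ->] := node_multiplier (iter n (vconic \o hconic) w).
  by rewrite lamV IH1 IH2 !mulrA -!exprS.
rewrite qrt_n_periodicP; split=> [per | lam1 w _].
- (* w is the point of the conic L1 L2 = k with L1 = 1 and L2 = k. *)
  pose k := e * f - a22.
  pose w : K * K := ((p * (k - f) - r * (1 - e)) / (p * s - q * r),
                     (s * (1 - e) - q * (k - f)) / (p * s - q * r)).
  have cw : conic w = 0.
    by rewrite /conic /w /= a20E a11E a02E a21E a12E /k; field.
  have [+ _] := iterE w; rewrite /= per //.
  have -> : p * w.2 + q * w.1 + e = 1 by rewrite /w /=; field.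
  by rewrite mulr1.
- have [] := iterE w; rewrite exprVn lam1 invr1 !mul1r.
  case: (iter _ _ _) => u' v'; case: w => u v /= /addIr h1 /addIr h2.
  (* [L1] and [L2] are unchanged, and Cramer's rule with determinant [p s - q r] recovers each
     coordinate. *)
  congr (_, _); apply: (mulfI d0).
    transitivity (p * (r * v' + s * u') - r * (p * v' + q * u')); first by ring.
    by rewrite h1 h2; ring.
  transitivity (s * (p * v' + q * u') - q * (r * v' + s * u')); first by ring.
  by rewrite h1 h2; ring.
Qed.

End Node.

(** The switches send [p v + q u] to its opposite minus [a12 / q] and minus [a21 / p] respectively,
    so their composition is a translation of this form. In characteristic zero no positive multiple
    of its nonzero step vanishes. *)
Lemma cusp_not_periodic p q : a20 = p ^+ 2 -> a02 = q ^+ 2 -> a11 = 2 * p * q ->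
  a12 * p != a21 * q -> ~ qrt_periodic Q.
Proof.
move=> a20E a02E a11E t0 [n n0 /qrt_n_periodicP per].
have : a20 * a02 != 0 by rewrite mulf_neq0.
rewrite a20E a02E mulf_eq0 !expf_eq0 /= negb_or => /andP[p0 q0].
pose t := (a12 * p - a21 * q) / (p * q).
have step w : let w' := vconic (hconic w) in
    p * w'.2 + q * w'.1 = p * w.2 + q * w.1 + t.
  by rewrite /= /t a20E a02E a11E; field; rewrite p0 q0.
have iterE w : let w' := iter n (vconic \o hconic) w in
    p * w'.2 + q * w'.1 = p * w.2 + q * w.1 + t *+ n.
  elim: n {n0 per} => [|n IH] /=; first by rewrite addr0.
  by rewrite step IH mulrS; ring.
(* The conic must have a point to contradict periodicity: take one on the line [v = 0]. *)
pose D := a12 ^+ 2 - 4 * a02 * a22.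
have cw : conic ((- a12 + sqrtC D) / (2 * a02), 0) = 0.
  rewrite /conic /=; transitivity ((sqrtC D ^+ 2 - D) / (4 * a02)).
    by rewrite /D; field.
  by rewrite sqrtCK subrr mul0r.
have := iterE ((- a12 + sqrtC D) / (2 * a02), 0); rewrite /= per //=.
move/eqP; rewrite -subr_eq0 opprD addrA subrr sub0r oppr_eq0 mulrn_eq0.
rewrite eqn0Ngt n0 /= /t mulf_eq0 invr_eq0 mulf_eq0 (negPf p0) (negPf q0) !orbF.
by rewrite subr_eq0 (negPf t0).
Qed.

End Correspondence.

Theorem theorem5p3 (R : realType) (a22 a21 a20 a12 a11 a02 : R[i]) :
  let Q : {poly {poly R[i]}} :=
    a22%:P%:P * 'X ^+ 2 * 'Y ^+ 2 + a21%:P%:P * 'X ^+ 2 * 'Y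
    + a20%:P%:P * 'X ^+ 2 + a12%:P%:P * 'X * 'Y ^+ 2
    + a11%:P%:P * 'X * 'Y + a02%:P%:P * 'Y ^+ 2 in
  irreducible_elt Q ->
  (a11 ^+ 2 != 4 * a20 * a02 ->
     ordinary_double_point Q /\
     forall n : nat, (0 < n)%N ->
       (qrt_n_periodic Q n <->
        exists m : nat,
          a11 ^+ 2 / (4 * a20 * a02) = (cos (m%:R / n%:R * pi) ^+ 2)%:C)) /\
  (a11 ^+ 2 = 4 * a20 * a02 -> cusp Q /\ ~ qrt_periodic Q).
Proof.
move=> Q irr; have a20_0 := irreducible_a20 _ _ _ _ _ _ _ irr.
have a02_0 := irreducible_a02 _ _ _ _ _ _ _ irr.
split=> [disc | disc].
- pose D : R[i] := sqrtC (a11 ^+ 2 - 4 * a20 * a02).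
  have D2 : D ^+ 2 = a11 ^+ 2 - 4 * a20 * a02 by rewrite sqrtCK.
  have D0 : D != 0.
    by apply: contraNneq disc => D0; rewrite -subr_eq0 -D2 D0 expr0n.
  (* Factors the quadratic part as [(a20 v + q u) (v + s u)], that is, [p = a20] and [r = 1], with
     determinant [D]. *)
  pose s := (a11 + D) / (2 * a20); pose q := (a11 - D) / 2.
  have a20E : a20 = a20 * 1 by rewrite mulr1.
  have a11E : a11 = a20 * s + q * 1 by rewrite /s /q; field.
  have a02E : a02 = q * s.
    transitivity ((a11 ^+ 2 - D ^+ 2) / (4 * a20)); first by rewrite D2; field.
    by rewrite /s /q; field.
  have det : a20 * s - q * 1 = D by rewrite /s /q; field.
  (* [e] and [f] solve the linear system [a21E], [a12E] by elimination; its determinant is again [D]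
     up to sign. *)
  clearbody s q; pose f := (s * a21 - a12) / D; pose e := a21 - a20 * f.
  have a21E : a21 = a20 * f + 1 * e by rewrite /e; ring.
  have a12E : a12 = q * f + s * e.
    transitivity (s * a21 - (a20 * s - q * 1) * f); last by rewrite /e; ring.
    by rewrite det /f; field.
  have det0 : a20 * s - q * 1 != 0 by rewrite det.
  split; first exact: node_ordinary a20E a11E a02E det0.
  move=> n n0.
  have [q0 s0] : q != 0 /\ s != 0.
    by apply/andP; rewrite -negb_or -mulf_eq0 -a02E.
  have tE : a11 ^+ 2 / (4 * a20 * a02)
      = (a20 * s / (q * 1) + 1) ^+ 2 / (4 * (a20 * s / (q * 1))).
    by rewrite a02E {1}a11E; field; rewrite a20_0 q0 s0.
  have lam0 : a20 * s / (q * 1) != 0.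
    by rewrite mulr1 !(mulf_eq0, invr_eq0) !negb_or a20_0 s0 q0.
  rewrite tE; apply: iff_trans (root_of_unity_cos _ _ _ n0 lam0).
  exact (node_periodic _ a22 _ _ _ _ _ a20_0 a02_0 _ _ _ _ _ _
    a20E a11E a02E a21E a12E n det0).
(* [q] is forced by [a11 = 2 p q]; the vanishing discriminant then gives [a02 = q ^+ 2]. *)
- pose p : R[i] := sqrtC a20; pose q := a11 / (2 * p).
  have a20E : a20 = p ^+ 2 by rewrite sqrtCK.
  have p0 : p != 0.
    by apply/eqP => p0; move: a20_0; rewrite a20E p0 expr0n eqxx.
  have a11E : a11 = 2 * p * q by rewrite /q; field.
  have a02E : a02 = q ^+ 2.
    transitivity (a11 ^+ 2 / (4 * a20)); first by rewrite disc; field.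
    by rewrite /q a20E; field.
  have q0 : q != 0.
    by apply/eqP => q0; move: a02_0; rewrite a02E q0 expr0n eqxx.
  have t0 := irreducible_cusp_neq _ _ _ _ _ _ _ _ _ irr p0 a20E a02E a11E.
  split; first exact: cusp_origin p0 q0 a20E a02E a11E t0.
  exact: (cusp_not_periodic _ _ _ _ _ _ _ a20_0 a02_0 _ _ a20E a02E a11E t0).
Qed.
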